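(* Let $w\in S_n$ and $\mathcal P\in\mathsf{Pipes}(w)$. Then $\mathcal P$ has a crossing tile in $\mathbb Y(\lambda^{(w)})$ if and only if $w$ is not vexillary. Furthermore, if $w$ is vexillary then $\mathsf{RPipes}(w)=\mathsf{Pipes}(w)$.
   Context: A permutation $w\in S_n$ is vexillary if there are no $i_1<i_2<i_3<i_4$ with $w_{i_2}<w_{i_1}<w_{i_4}<w_{i_3}$ (it avoids $2143$). Bumpless pipe dreams. Cells $(i,j)$ of the $n\times n$ grid: row $i$ from the top, column $j$ from the left. There are six tiles: downward elbow (a pipe joining the bottom and right edges), upward elbow (a pipe joining the left and top edges), crossing (one pipe joining left and right edges and one joining bottom and top edges), blank (no pipe), horizontal (left to right), vertical (bottom to top). A bumpless pipe dream (BPD) of size $n$ is a tiling of the grid by these tiles such that an edge shared by two cells is met by a pipe from both sides or from neither, every bottom and right boundary edge is met by a pipe, and no left or top boundary edge is met by a pipe. So there are $n$ pipes, running from the bottom boundary to the right boundary. A BPD is reduced if every pair of pipes crosses at most once. Demazure product $\partial(\mathcal P)\in S_n$: label the bottom boundary edges $1,\dots,n$ from left to right and propagate labels along pipes north and east; at a crossing tile, of the two labels entering from the left and from below, the smaller leaves through the right edge and the larger through the top edge. $\partial(\mathcal P)(i)$ is the label arriving at the right boundary edge of row $i$. $\mathsf{Pipes}(w)=\{\mathcal P:\partial(\mathcal P)=w\}$ and $\mathsf{RPipes}(w)=\{\mathcal P\in\mathsf{Pipes}(w):\mathcal P\text{ is reduced}\}$. The Rothe diagram is $D(w)=\{(i,j):w_i>j,\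 w^{-1}(j)>i\}$. $\lambda^{(w)}$ is the partition whose diagram is $\mathbb Y(\lambda^{(w)})=\bigcup_{(i,j)\in D(w)}[1,i]\times[1,j]$, where $\mathbb Y(\lambda)=\{(i,j):1\le j\le\lambda_i\}$. *)

(* Defs.v *)
From HB Require Import structures.
From mathcomp Require Import all_boot all_fingroup all_algebra.

Set Implicit Arguments.
Unset Strict Implicit.
Unset Printing Implicit Defensive.

(* Rows and columns, labels and the values of permutations are numbered from 0;
   row 0 is the top row, column 0 the leftmost one. *)

Inductive tile :=
  DownElbow | UpElbow | Crossing | BlankTile | Horizontal | Vertical.

Definition tile_code (t : tile) : nat :=
  match t with
  | DownElbow => 0 | UpElbow => 1 | Crossing => 2
  | BlankTile => 3 | Horizontal => 4 | Vertical => 5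
  end.

Definition all_tiles : seq tile :=
  [:: DownElbow; UpElbow; Crossing; BlankTile; Horizontal; Vertical].

Lemma tile_codeK : cancel tile_code (nth BlankTile all_tiles).
Proof. by case. Qed.

HB.instance Definition _ := Countable.copy tile (can_type tile_codeK).

Lemma all_tilesP : Finite.axiom all_tiles.
Proof. by case. Qed.

HB.instance Definition _ := isFinite.Build tile all_tilesP.

Definition meets_left (t : tile) : bool :=
  match t with UpElbow | Crossing | Horizontal => true | _ => false end.
Definition meets_right (t : tile) : bool :=
  match t with DownElbow | Crossing | Horizontal => true | _ => false end.
Definition meets_top (t : tile) : bool :=
  match t with UpElbow | Crossing | Vertical => true | _ => false end.
Definition meets_bottom (t : tile) : bool :=
  match t with DownElbow | Crossing | Vertical => true | _ => false end.

Definition is_bpd n (P : 'M[tile]_n) : bool :=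
  [&& [forall i : 'I_n, forall j : 'I_n, forall j' : 'I_n,
        (j' == j.+1 :> nat) ==> (meets_right (P i j) == meets_left (P i j'))],
      [forall i : 'I_n, forall i' : 'I_n, forall j : 'I_n,
        (i' == i.+1 :> nat) ==> (meets_bottom (P i j) == meets_top (P i' j))],
      [forall i : 'I_n, forall j : 'I_n,
        (i.+1 == n) ==> meets_bottom (P i j)],
      [forall i : 'I_n, forall j : 'I_n,
        (j.+1 == n) ==> meets_right (P i j)],
      [forall i : 'I_n, forall j : 'I_n,
        (j == 0 :> nat) ==> ~~ meets_left (P i j)]
    & [forall i : 'I_n, forall j : 'I_n,
        (i == 0 :> nat) ==> ~~ meets_top (P i j)]].

Record bpd (n : nat) := BPD {
  bpd_tiles :> 'M[tile]_n;
  bpd_tilesP : is_bpd bpd_tiles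
}.

HB.instance Definition _ n := [isSub for @bpd_tiles n].
HB.instance Definition _ n := [Finite of bpd n by <:].

Section Labels.

Variable n : nat.

(* The label of an edge; [None] when no pipe meets the edge. *)
Local Notation label := (option 'I_n).

(* [rule l b] is the pair of labels leaving a crossing through its right and
   top edges when [l] enters from the left and [b] from below. *)
Variable rule : 'I_n -> 'I_n -> 'I_n * 'I_n.

(* The labels of the right and top edges of a tile, from those of its left and
   bottom edges. *)
Definition exit_labels (t : tile) (l b : label) : label * label :=
  match t with
  | DownElbow => (b, None)
  | UpElbow => (None, l)
  | Crossing =>
      if (l, b) is (Some x, Some y)
      then (Some (rule x y).1, Some (rule x y).2) else (None, None)
  | BlankTile => (None, None)
  | Horizontal => (l, None)
  | Vertical => (None, b)
  end.

(* [row_label row bot j] is the label of the left edge of column [j] in a row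
   of tiles whose bottom edges are labelled by [bot]; for [j = n] this is the
   right boundary edge of the row. *)
Fixpoint row_label (row : nat -> tile) (bot : nat -> label) (j : nat) : label :=
  if j is j'.+1
  then (exit_labels (row j') (row_label row bot j') (bot j')).1 else None.

Variable P : 'M[tile]_n.

Definition tile_at (i j : nat) : tile :=
  if (insub i, insub j) is (Some i', Some j') then P i' j' else BlankTile.

(* [level_label k j] is the label of the edge in column [j] at height [k] above
   the bottom boundary, whose edges are labelled by their columns. *)
Fixpoint level_label (k : nat) : nat -> label :=
  if k is k'.+1 then
    fun j =>
      let row := tile_at (n - k'.+1) in
      let bot := level_label k' in
      (exit_labels (row j) (row_label row bot j) (bot j)).2
  else fun j => insub j.

Definition bottom_label (i j : nat) : label := level_label (n - i.+1) j.

Definition left_label (i j : nat) : label :=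
  row_label (tile_at i) (bottom_label i) j.

End Labels.

Definition straight_rule n (l b : 'I_n) : 'I_n * 'I_n := (l, b).

Definition demazure_rule n (l b : 'I_n) : 'I_n * 'I_n :=
  if l <= b then (l, b) else (b, l).

Definition demazure n (P : bpd n) (i : 'I_n) : option 'I_n :=
  left_label (@demazure_rule n) P i n.

(* A pipe is identified with the column of its bottom boundary edge; the labels
   propagated with [straight_rule] record which pipe meets each edge. *)
Definition crossings n (P : bpd n) (p q : 'I_n) : {set 'I_n * 'I_n} :=
  [set c : 'I_n * 'I_n |
    let entering := (left_label (@straight_rule n) P c.1 c.2,
                     bottom_label (@straight_rule n) P c.1 c.2) in
    (P c.1 c.2 == Crossing) &&
    ((entering == (Some p, Some q)) || (entering == (Some q, Some p)))].

Definition reduced n (P : bpd n) : bool :=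
  [forall p : 'I_n, forall q : 'I_n, (p != q) ==> (#|crossings P p q| <= 1)].

Definition Pipes n (w : 'S_n) : {set bpd n} :=
  [set P | [forall i : 'I_n, demazure P i == Some (w i)]].

Definition RPipes n (w : 'S_n) : {set bpd n} :=
  [set P in Pipes w | reduced P].

Definition vexillary n (w : 'S_n) : bool :=
  ~~ [exists i1 : 'I_n, exists i2 : 'I_n, exists i3 : 'I_n, exists i4 : 'I_n,
        [&& i1 < i2, i2 < i3, i3 < i4, w i2 < w i1, w i1 < w i4 & w i4 < w i3]].

Definition rothe n (w : 'S_n) : {set 'I_n * 'I_n} :=
  [set c : 'I_n * 'I_n | (c.2 < w c.1) && (c.1 < (w^-1)%g c.2)].

Definition young n (lam : 'I_n -> nat) : {set 'I_n * 'I_n} :=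
  [set c : 'I_n * 'I_n | c.2 < lam c.1].

(* The row lengths of the union of the rectangles with northwest corner (0, 0)
   and southeast corner in the Rothe diagram; see [young_lambda]. *)
Definition lambda n (w : 'S_n) (i : 'I_n) : nat :=
  \max_(c in rothe w | i <= c.1) c.2.+1.

Lemma young_lambda n (w : 'S_n) :
  young (lambda w) =
  \bigcup_(c in rothe w) [set d : 'I_n * 'I_n | (d.1 <= c.1) && (d.2 <= c.2)].
Proof.
apply/setP=> d; rewrite inE; apply/idP/bigcupP => [|[c cD]].
  move=> lt_d.
  case: (pickP [pred c in rothe w | (d.1 <= c.1) && (d.2 <= c.2)]) => [c|noc].
    by case/andP=> cD le_dc; exists c; rewrite // inE.
  move: lt_d; rewrite ltnNge => /bigmax_leqP[] c /andP[cD le1].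
  by have:= noc c; rewrite inE /= cD le1 /= leqNgt => /negbFE.
by rewrite inE => /andP[le1 le2]; apply: (bigmax_sup c); rewrite ?cD.
Qed.

Lemma lambda_noninc n (w : 'S_n) (i i' : 'I_n) :
  i <= i' -> lambda w i' <= lambda w i.
Proof.
move=> le_ii'; apply/bigmax_leqP => c /andP[cD le1].
by apply: (bigmax_sup c); rewrite ?cD ?(leq_trans le_ii').
Qed.

(* Main.v *)
(* Let a lattice path sweep the grid cell by cell. The labels on it, read from its
   northwest to its southeast end, start as 0, ..., n-1 and end as
   w(0), ..., w(n-1); this sequence changes only at crossings entered by x from the left
   and y > x from below, which swap x and y. Hence two labels form an inversion
   of w iff they meet at a crossing, and after meeting they stay inverted.

   Outside Y(lambda) the labels are forced, by induction from the southeast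
   corner: the right edge of (a, b) carries w(a) if w(a) <= b and nothing
   otherwise, and the bottom edge carries b if w^-1(b) <= a and nothing otherwise.
   At a crossing there, w(a) enters from the left and b > w(a) from below.

   A crossing in the rectangle northwest of (i, j) in D(w) is thus met by
   inverted labels <= j whose exit rows are <= i, which with i and w^-1(j) form a
   2143. Conversely, given a 2143 at i1 < i2 < i3 < i4, the labels w(i1) and w(i2)
   cross; were this outside Y(lambda) it would be at (i2, w(i1)), which is
   northwest of (i3, w(i4)) in D(w). If w is vexillary, all crossings are outside
   Y(lambda), so the Demazure labels agree with the pipes, and p < q cross at most
   at (w^-1(p), q). *)

Require Import Defs.
From mathcomp Require Import all_boot all_fingroup all_algebra.
From mathcomp Require Import zify.

Set Implicit Arguments.
Unset Strict Implicit.
Unset Printing Implicit Defensive.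

(** * Edge labels of a bumpless pipe dream and lattice paths through it, for any crossing rule *)

Section BpdLabels.

Variables (n : nat) (P : bpd n).

Lemma tile_at_ord (i j : 'I_n) : tile_at P i j = P i j.
Proof. by rewrite /tile_at !valK. Qed.

Lemma meets_right_left i j : i < n -> j.+1 < n ->
  meets_right (tile_at P i j) = meets_left (tile_at P i j.+1).
Proof.
move=> ltin ltjn.
case/and5P: (bpd_tilesP P) => /forallP/(_ (Ordinal ltin)) H _ _ _ _.
have /forallP/(_ (Ordinal ltjn)) := forallP H (Ordinal (ltnW ltjn)).
by rewrite eqxx -!tile_at_ord => /eqP.
Qed.

Lemma meets_bottom_top i j : i.+1 < n -> j < n ->
  meets_bottom (tile_at P i j) = meets_top (tile_at P i.+1 j).
Proof.
move=> ltin ltjn.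
case/and5P: (bpd_tilesP P) => _ /forallP/(_ (Ordinal (ltnW ltin))) H _ _ _.
have /forallP/(_ (Ordinal ltjn)) := forallP H (Ordinal ltin).
by rewrite eqxx -!tile_at_ord => /eqP.
Qed.

Lemma meets_bottom_boundary j : j < n -> meets_bottom (tile_at P n.-1 j).
Proof.
move=> ltjn; have ltin : n.-1 < n by lia.
case/and5P: (bpd_tilesP P) => _ _ /forallP/(_ (Ordinal ltin)) + _ _.
move=> /forallP/(_ (Ordinal ltjn)).
by rewrite -tile_at_ord /= prednK ?eqxx //; lia.
Qed.

Lemma meets_left_boundary i : i < n -> meets_left (tile_at P i 0) = false.
Proof.
move=> ltin; have lt0n : 0 < n by lia.
case/and5P: (bpd_tilesP P) => _ _ _ _ /andP[/forallP/(_ (Ordinal ltin)) + _].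
move=> /forallP/(_ (Ordinal lt0n)).
by rewrite -tile_at_ord /= => /negbTE.
Qed.

Lemma meets_top_boundary j : j < n -> meets_top (tile_at P 0 j) = false.
Proof.
move=> ltjn; have lt0n : 0 < n by lia.
case/and5P: (bpd_tilesP P) => _ _ _ _ /andP[_ /forallP/(_ (Ordinal lt0n))].
move=> /forallP/(_ (Ordinal ltjn)).
by rewrite -tile_at_ord /= => /negbTE.
Qed.

Section Rule.

Variable rule : 'I_n -> 'I_n -> 'I_n * 'I_n.

(** Height [n - i] is the top side of row [i]; unlike [bottom_label], this indexing also reaches the
    top boundary. *)
Definition top_label i j := level_label rule P (n - i) j.

Local Notation left_label := (left_label rule P).
Local Notation bottom_label := (bottom_label rule P).

Definition exit_at i j :=
  exit_labels rule (tile_at P i j) (left_label i j) (bottom_label i j).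

Lemma left_labelS i j : left_label i j.+1 = (exit_at i j).1.
Proof. by []. Qed.

Lemma bottom_labelE i j : bottom_label i j = top_label i.+1 j.
Proof. by []. Qed.

Lemma top_labelE i j : i < n -> top_label i j = (exit_at i j).2.
Proof.
move=> ltin; rewrite /top_label /exit_at /Defs.left_label /Defs.bottom_label.
by rewrite -(subnSK ltin) /= subnSK // subKn // ltnW.
Qed.

Lemma bottom_label_boundary j : bottom_label n.-1 j = insub j.
Proof. by rewrite /Defs.bottom_label (_ : n - n.-1.+1 = 0) //; lia. Qed.

Lemma exit_labels_isSome (t : tile) (l b : option 'I_n) :
    isSome l = meets_left t -> isSome b = meets_bottom t ->
  isSome (exit_labels rule t l b).1 = meets_right t /\
  isSome (exit_labels rule t l b).2 = meets_top t.
Proof. by case: t l b => [] [x|] [y|]. Qed.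

Lemma left_label_isSome_of i :
    i < n ->
    (forall j, j < n ->
       isSome (bottom_label i j) = meets_bottom (tile_at P i j)) ->
  forall j, j < n -> isSome (left_label i j) = meets_left (tile_at P i j).
Proof.
move=> ltin botE; elim=> [|j IHj] ltjn; first by rewrite meets_left_boundary.
rewrite left_labelS -meets_right_left //.
by have [] := exit_labels_isSome (IHj (ltnW ltjn)) (botE _ (ltnW ltjn)).
Qed.

(** Every tile turns labels on its incoming pipe edges into labels on its outgoing ones, so upward
    induction shows that labels sit exactly on the edges met by a pipe. In particular the
    [(None, None)] default at a crossing never occurs. *)
Lemma bottom_label_isSome i j :
  i < n -> j < n -> isSome (bottom_label i j) = meets_bottom (tile_at P i j).
Proof.
(* Here [k] is the distance of row [i] from the bottom row. *)
move: i j; suff H k : forall i j, i + k = n.-1 -> i < n -> j < n ->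
    isSome (bottom_label i j) = meets_bottom (tile_at P i j).
  by move=> i j ltin; apply: (H (n.-1 - i)); rewrite ?subnKC //; lia.
elim: k => [|k IHk] i j.
  rewrite addn0 => -> _ ltjn; rewrite bottom_label_boundary insubT /=.
  by rewrite meets_bottom_boundary.
move=> eqi ltin ltjn; have lti1n : i.+1 < n by lia.
rewrite bottom_labelE top_labelE // meets_bottom_top //.
have botE j' : j' < n ->
    isSome (bottom_label i.+1 j') = meets_bottom (tile_at P i.+1 j').
  by move=> ?; apply: IHk; rewrite ?addSnnS.
by have [] := exit_labels_isSome (left_label_isSome_of lti1n botE ltjn)
  (botE _ ltjn).
Qed.

Lemma left_label_isSome i j :
  i < n -> j < n -> isSome (left_label i j) = meets_left (tile_at P i j).
Proof.
by move=> ltin; apply: left_label_isSome_of => // j'; apply: bottom_label_isSome.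
Qed.

Lemma top_label_isSome i j :
  i < n -> j < n -> isSome (top_label i j) = meets_top (tile_at P i j).
Proof.
move=> ltin ltjn; rewrite top_labelE //.
by have [] := exit_labels_isSome (left_label_isSome ltin ltjn)
  (bottom_label_isSome ltin ltjn).
Qed.

End Rule.

(* The edges of a lattice path from the left boundary to the southeast corner: top
   edges of row [a] left of column [b], left edge of cell [(a, b)], bottom edges
   of row [a] from column [b] on, right boundary edges below row [a]. *)
Definition frontier rule a b :=
  [seq top_label rule a j | j <- iota 0 b] ++ left_label rule P a b ::
  [seq bottom_label rule P a j | j <- iota b (n - b)] ++
  [seq left_label rule P r n | r <- iota a.+1 (n - a.+1)].

(** Pushing the path across one cell trades its left and bottom edges for its top and right edges,
    in this order along the path. *)
Lemma frontier_step rule a b : a < n -> b < n ->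
  exists s1 s2,
    frontier rule a b =
      s1 ++ [:: left_label rule P a b; bottom_label rule P a b] ++ s2 /\
    frontier rule a b.+1 =
      s1 ++ [:: (exit_at rule a b).2; (exit_at rule a b).1] ++ s2.
Proof.
move=> ltan ltbn; rewrite /frontier -(subnSK ltbn).
rewrite -(addn1 b) iotaD map_cat -catA /= addn1 top_labelE //.
by eexists; eexists; split.
Qed.

(** The two paths differ only by the left boundary edge of row [a], which carries [None]. *)
Lemma frontier_row rule (Q : pred (option 'I_n)) a : a.+1 < n -> ~~ Q None ->
  filter Q (frontier rule a.+1 n) = filter Q (frontier rule a 0).
Proof.
move=> ltan /negbTE QN; rewrite /frontier subnn /= QN subn0.
by rewrite -(subnSK ltan).
Qed.

Lemma frontier_bottom rule (Q : pred (option 'I_n)) : 0 < n -> ~~ Q None ->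
  filter Q (frontier rule n.-1 0) = filter Q [seq Some i | i <- enum 'I_n].
Proof.
move=> n_gt0 /negbTE QN; rewrite /frontier /= QN subn0 prednK // subnn cats0.
congr filter; rewrite -val_enum_ord -map_comp; apply: eq_map => i /=.
by rewrite bottom_label_boundary valK.
Qed.

Lemma frontier_top rule (Q : pred (option 'I_n)) : 0 < n -> ~~ Q None ->
  filter Q (frontier rule 0 n) =
  filter Q [seq left_label rule P i n | i : 'I_n].
Proof.
move=> n_gt0 QN.
have -> : [seq left_label rule P i n | i : 'I_n] =
    [seq left_label rule P r n | r <- iota 0 n].
  by rewrite -val_enum_ord -map_comp.
have -> : iota 0 n = 0 :: iota 1 (n - 1).
  by case: (n) n_gt0 => // m _; rewrite subn1.
rewrite /frontier subnn filter_cat (_ : filter Q (map _ _) = [::]) //.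
rewrite -(filter_pred0 [seq top_label rule 0 j | j <- iota 0 n]).
apply: eq_in_filter => _ /mapP[j + ->] /=; rewrite mem_iota /= => ltjn.
have := top_label_isSome rule n_gt0 ltjn; rewrite meets_top_boundary //.
by case: top_label => // _; apply: negbTE.
Qed.

End BpdLabels.

(** * Demazure labels along a sweeping lattice path *)

Section DemazureLabels.

Variables (n : nat) (P : bpd n).

Local Notation rule := (@demazure_rule n).
Local Notation left_label := (left_label rule P).
Local Notation bottom_label := (bottom_label rule P).
Local Notation top_label := (top_label P rule).
Local Notation exit_at := (exit_at P rule).
Local Notation frontier := (frontier P rule).

(** A label starts at its own column and travels only north and east. The left edge of column [j] is
    the right edge of column [j - 1], hence the strict bound. *)
Lemma left_bottom_label_le i j :
  (forall x : 'I_n, left_label i j = Some x -> x < j) /\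
  (forall x : 'I_n, bottom_label i j = Some x -> x <= j).
Proof.
rewrite /Defs.left_label /Defs.bottom_label.
set lev := level_label _ P; move: (n - i.+1) (tile_at P i) => k t.
have row_lt (row : nat -> tile) bot j' :
    (forall j (x : 'I_n), bot j = Some x -> x <= j) ->
    forall x : 'I_n, row_label rule row bot j' = Some x -> x < j'.
  move=> bot_le; elim: j' => [|j' IHj] x //=.
  case: (row j') (row_label rule row bot j') IHj (bot j') (bot_le j') => //=.
  - by move=> _ _ b H /H.
  - move=> [l|] // /(_ _ erefl) ltl [b|] // /(_ _ erefl) leb.
    by rewrite /demazure_rule; case: ifP => _ [<-] //=; apply: leqW.
  - by move=> l H b _ /H/leqW.
have lev_le k' : forall j (x : 'I_n), lev k' j = Some x -> x <= j.
  elim: k' => [|k' IHk] j' x /=; first by case: insubP => // u _ <- [->].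
  set l := row_label _ _ _ _.
  have := row_lt _ _ _ IHk : forall x : 'I_n, l = Some x -> x < j'.
  case: (tile_at _ _ _) (lev k' j') (IHk j') => //=.
  - by move=> b _ H /H/ltnW.
  - case: l => // l [b|] // /(_ _ erefl) leb /(_ _ erefl) ltl.
    by rewrite /demazure_rule; case: ifP => _ [<-] //=; apply: ltnW.
  - by move=> b H _ /H.
by split=> x; [apply: row_lt; apply: lev_le | apply: lev_le].
Qed.

(** The path reads [l], [b] before the cell and [r.2], [r.1] after it. The labels read change order
    only at a crossing with the smaller one on the left. *)
Lemma exit_labels_demazure (t : tile) (l b : option 'I_n) :
    isSome l = meets_left t -> isSome b = meets_bottom t ->
  let r := exit_labels rule t l b in
  (forall Q : pred (option 'I_n), ~~ Q None ->
     filter Q [:: r.2; r.1] = filter Q [:: l; b]) \/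
  exists x y : 'I_n,
    [/\ t = Crossing, l = Some x, b = Some y, x < y & r = (l, b)].
Proof.
case: t l b => [] [x|] [y|] //= _ _; try by left => Q /negbTE ->.
rewrite /demazure_rule; case: (ltngtP x y) => [ltxy | ltyx | /val_inj ->] /=.
- by right; exists x, y.
- by left.
- by left.
Qed.

Lemma crossing_exit (x y : 'I_n) : x < y ->
  exit_labels rule Crossing (Some x) (Some y) = (Some x, Some y) /\
  exit_labels rule Crossing (Some y) (Some x) = (Some x, Some y).
Proof. by move=> ltxy; rewrite /= /demazure_rule (ltnW ltxy) leqNgt ltxy. Qed.

Section FrontierInduction.

Variables (Q : pred (option 'I_n)) (R : seq (option 'I_n) -> Prop).
Hypothesis QN : ~~ Q None.
Hypothesis R_step : forall a b, a < n -> b < n ->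
  R (filter Q (frontier a b)) -> R (filter Q (frontier a b.+1)).

Lemma frontier_ind_row a b c : a < n -> b + c <= n ->
  R (filter Q (frontier a b)) -> R (filter Q (frontier a (b + c))).
Proof.
move=> ltan; elim: c => [|c IHc] lebc Rb; first by rewrite addn0.
by rewrite addnS; apply: R_step; [|lia|apply: IHc => //; lia].
Qed.

Lemma frontier_ind_rows a c : a + c < n ->
  R (filter Q (frontier (a + c) 0)) -> R (filter Q (frontier a 0)).
Proof.
elim: c => [|c IHc] ltac Rc; first by rewrite addn0 in Rc.
apply: IHc; first by lia.
rewrite -frontier_row //; last by lia.
rewrite addnS in ltac Rc.
by have := @frontier_ind_row _ 0 n ltac (leqnn n) Rc.
Qed.

(** With [frontier_ind_top], this carries a property preserved by every cell from the bottom
    boundary to any path, and from there to the right boundary. *)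
Lemma frontier_ind_bottom a b : a < n -> b <= n ->
  R (filter Q [seq Some i | i <- enum 'I_n]) -> R (filter Q (frontier a b)).
Proof.
move=> ltan lebn R0; apply: (@frontier_ind_row a 0 b) => //.
apply: (@frontier_ind_rows a (n.-1 - a)); first by lia.
rewrite subnKC; last by lia.
by rewrite frontier_bottom //; lia.
Qed.

Lemma frontier_ind_top a b : a < n -> b <= n -> R (filter Q (frontier a b)) ->
  R (filter Q [seq left_label i n | i : 'I_n]).
Proof.
move=> ltan lebn Rab; rewrite -frontier_top //; last by lia.
suff: forall a, a < n ->
    R (filter Q (frontier a n)) -> R (filter Q (frontier 0 n)).
  apply; first exact: ltan.
  by have := @frontier_ind_row a b (n - b) ltan; rewrite subnKC //; apply.
elim=> [|a' IHa] // lta' Rn; apply: IHa; first by lia.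
apply: (@frontier_ind_row _ 0 n) => //; first by lia.
by rewrite -frontier_row.
Qed.

End FrontierInduction.

Lemma size_frontier (Q : pred (option 'I_n)) a b : ~~ Q None -> a < n -> b <= n ->
  size (filter Q (frontier a b)) = size (filter Q [seq Some i | i <- enum 'I_n]).
Proof.
move=> QN ltan lebn.
apply: (@frontier_ind_bottom Q (fun s => size s = _)) => // a' b' lta ltb <-.
have [s1 [s2 [-> ->]]] := frontier_step P rule lta ltb.
rewrite !filter_cat !size_cat; congr (_ + (_ + _)).
have := exit_labels_demazure (left_label_isSome P rule lta ltb)
  (bottom_label_isSome P rule lta ltb).
case=> [-> // | [x [y [_ _ _ _]]]]; rewrite -/(exit_at _ _) => -> /=.
by do 2 case: ifP.
Qed.

(** Each cell at most permutes labels, so the number of selected ones stays as on the bottom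
    boundary; here a single label is selected. *)
Lemma count_frontier (x : 'I_n) a b : a < n -> b <= n ->
  count_mem (Some x) (frontier a b) = 1.
Proof.
move=> ltan lebn; rewrite -size_filter size_frontier // size_filter count_map.
rewrite (eq_count (a2 := pred1 x)) => [|i]; last by rewrite /= (inj_eq Some_inj).
by rewrite count_uniq_mem ?enum_uniq // mem_enum.
Qed.

End DemazureLabels.

(** * Relative order of two labels *)

Lemma filter_pair_enum n (i j : 'I_n) : i < j ->
  filter (pred2 i j) (enum 'I_n) = [:: i; j].
Proof.
move=> ltij; apply: (@irr_sorted_eq _ (relpre val ltn)).
- by move=> ? ? ?; apply: ltn_trans.
- by move=> ?; apply: ltnn.
- apply: sorted_filter; first by move=> ? ? ?; apply: ltn_trans.
  by rewrite -sorted_map val_enum_ord iota_ltn_sorted.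
- by rewrite /= ltij.
by move=> k; rewrite mem_filter mem_enum andbT !inE.
Qed.

(** Filtering a path by this predicate leaves only the relative order of [p] and [q]. *)
Definition opair n (p q : 'I_n) : pred (option 'I_n) := pred2 (Some p) (Some q).

Lemma filter_opair_perm n (w : 'S_n) (p q : 'I_n) : (w^-1)%g p < (w^-1)%g q ->
  filter (opair p q) [seq Some (w i) | i : 'I_n] = [:: Some p; Some q].
Proof.
move=> ltpq; rewrite filter_map (eq_filter (a2 := pred2 (w^-1 p)%g (w^-1 q)%g)).
  by rewrite filter_pair_enum //= !permKV.
by move=> i; rewrite /opair /= !(inj_eq Some_inj) !(canF_eq (permK w)).
Qed.

Lemma filter_opair_swap n (p q x y : 'I_n) : p < q -> x < y ->
  (x = p /\ y = q) \/
  filter (opair p q) [:: Some y; Some x] =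
  filter (opair p q) [:: Some x; Some y].
Proof.
move=> ltpq ltxy; rewrite /opair /= !(inj_eq Some_inj).
case: (boolP ((x == p) || (x == q))) => hx;
  case: (boolP ((y == p) || (y == q))) => hy; try by right.
left; case/orP: hx ltxy => /eqP ->; case/orP: hy => /eqP ->; rewrite ?ltnn //.
by move=> ltqp; have := ltn_trans ltpq ltqp; rewrite ltnn.
Qed.

Lemma filter_opair_bottom n (p q : 'I_n) : p < q ->
  filter (opair p q) [seq Some i | i <- enum 'I_n] = [:: Some p; Some q].
Proof.
have := @filter_opair_perm n 1 p q; rewrite invg1 !perm1 => E /E <-.
by congr filter; apply: eq_map => i; rewrite perm1.
Qed.

(** * Inversions of [w] and crossings *)

Section DemazureProduct.

Variables (n : nat) (w : 'S_n) (P : bpd n).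
Hypothesis Pw : P \in Pipes w.

Local Notation rule := (@demazure_rule n).
Local Notation left_label := (left_label rule P).
Local Notation bottom_label := (bottom_label rule P).

Lemma right_boundary_label (i : 'I_n) : left_label i n = Some (w i).
Proof. by move: Pw; rewrite inE => /forallP/(_ i)/eqP. Qed.

Lemma right_boundary_labels :
  [seq left_label i n | i : 'I_n] = [seq Some (w i) | i : 'I_n].
Proof. by apply: eq_map => i; apply: right_boundary_label. Qed.

(** Without such a crossing, the order [p], [q] on the bottom boundary would persist to the right
    boundary, where [q] comes first. *)
Lemma crossing_of_inversion (p q : 'I_n) : p < q -> (w^-1)%g q < (w^-1)%g p ->
  exists a b : 'I_n,
    [/\ P a b = Crossing, left_label a b = Some p & bottom_label a b = Some q].
Proof.
move=> ltpq ltqp.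
case: (pickP [pred c : 'I_n * 'I_n | [&& P c.1 c.2 == Crossing,
   left_label c.1 c.2 == Some p & bottom_label c.1 c.2 == Some q]])
  => [[a b]|nocross].
  by case/and3P=> /eqP ? /eqP ? /eqP ?; exists a, b.
have n_gt0 : 0 < n by apply: leq_trans (ltn_ord p).
have := @frontier_ind_bottom n P (opair p q) (eq [:: Some p; Some q]) isT _
  n.-1 0 _ (leq0n _).
have step a b : a < n -> b < n ->
    [:: Some p; Some q] = filter (opair p q) (frontier P rule a b) ->
    [:: Some p; Some q] = filter (opair p q) (frontier P rule a b.+1).
  move=> lta ltb.
  have [s1 [s2 [-> ->]]] := frontier_step P rule lta ltb.
  rewrite !filter_cat => ->; congr (_ ++ (_ ++ _)).
  have := exit_labels_demazure (left_label_isSome P rule lta ltb)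
    (bottom_label_isSome P rule lta ltb).
  case=> [<- // | [x [y [eqt eql eqb ltxy]]]].
  rewrite -/(exit_at _ _ _ _) => ->; rewrite eql eqb.
  case: (filter_opair_swap ltpq ltxy) => [[eqx eqy]|-> //].
  have := nocross (Ordinal lta, Ordinal ltb); rewrite /= -tile_at_ord /= eqt.
  by rewrite eql eqb eqx eqy !eqxx.
move=> /(_ step); rewrite filter_opair_bottom // => H.
have ltin : n.-1 < n by lia.
have := @frontier_ind_top n P (opair p q) (eq [:: Some p; Some q]) isT step
  n.-1 0 ltin (leq0n _) (H ltin erefl).
rewrite right_boundary_labels (eq_filter (a2 := opair q p)) => [|o]; last first.
  by rewrite /opair /= orbC.
by rewrite filter_opair_perm // => -[eqpq]; rewrite eqpq ltnn in ltpq.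
Qed.

(** Whichever way they enter, [q] precedes [p] on the path after the crossing. A swap needs the
    smaller label first, so this order is never undone. *)
Lemma inversion_of_crossing (p q a b : 'I_n) : p < q -> P a b = Crossing ->
    (left_label a b = Some p /\ bottom_label a b = Some q) \/
    (left_label a b = Some q /\ bottom_label a b = Some p) ->
  (w^-1)%g q < (w^-1)%g p.
Proof.
move=> ltpq cross lbE.
have exitE : exit_at P rule a b = (Some p, Some q).
  rewrite /exit_at tile_at_ord cross; have [E1 E2] := crossing_exit ltpq.
  by case: lbE => [[-> ->]|[-> ->]].
(* The filtered path has size 2, so the two exit edges of the crossing leave no further occurrence
   in [s1] or [s2]. *)
have after : [:: Some q; Some p] = filter (opair p q) (frontier P rule a b.+1).
  have := @size_frontier n P (opair p q) a b.+1 isT (ltn_ord a) (ltn_ord b).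
  rewrite filter_opair_bottom //.
  have [s1 [s2 [_ ->]]] := frontier_step P rule (ltn_ord a) (ltn_ord b).
  rewrite exitE !filter_cat !size_cat /opair /= !eqxx !orbT /=.
  by case: (filter _ s1) => //; case: (filter _ s2) => //=; lia.
have := @frontier_ind_top n P (opair p q) (eq [:: Some q; Some p]) isT _
  a b.+1 (ltn_ord a) (ltn_ord b) after.
rewrite right_boundary_labels => final.
case: (ltngtP ((w^-1)%g q) ((w^-1)%g p)) => //
  [ltpq'|/val_inj/perm_inj eqpq]; last first.
  by rewrite eqpq ltnn in ltpq.
move: final; rewrite filter_opair_perm // => final.
suff [eqpq]: [:: Some q; Some p] = [:: Some p; Some q] by rewrite eqpq ltnn in ltpq.
apply: final => a' b' lta ltb.
have [s1 [s2 [-> ->]]] := frontier_step P rule lta ltb.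
rewrite !filter_cat => s12E; rewrite s12E.
have := exit_labels_demazure (left_label_isSome P rule lta ltb)
  (bottom_label_isSome P rule lta ltb).
case=> [<- // | [x [y [eqt eql eqb ltxy]]]].
rewrite -/(exit_at _ _ _ _) => ->; rewrite eql eqb in s12E *.
case: (filter_opair_swap ltpq ltxy) => [[eqx eqy]|-> //].
move: s12E; rewrite eqx eqy /opair /= !eqxx !orbT /=.
case: (filter _ s1) => [|? [|? [|? ?]]] //= [eqqp].
by rewrite eqqp ltnn in ltpq.
Qed.

(** Otherwise [x] would occur twice on one path: at the cell and on a right boundary edge below row
    [a]. *)
Lemma exit_row_le (a b x : 'I_n) :
  left_label a b = Some x \/ bottom_label a b = Some x -> (w^-1)%g x <= a.
Proof.
move=> lbx; rewrite leqNgt; apply/negP => lta.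
have := @count_frontier n P x a b (ltn_ord a) (ltnW (ltn_ord b)).
rewrite /frontier -cat_cons count_cat count_cat -(subnSK (ltn_ord b)).
set c1 := count _ _; set c2 := count _ _; set c3 := count _ _.
suff: 0 < c2 /\ 0 < c3 by lia.
split; rewrite -has_count has_pred1.
  by rewrite /= !inE; case: lbx => ->; rewrite eqxx ?orbT.
apply/mapP; exists (val ((w^-1)%g x)); last by rewrite right_boundary_label permKV.
by rewrite mem_iota lta subnKC /=.
Qed.


(** Propagation is run backwards: the cells to the south and east are also outside, so the bottom
    and right labels are known, and they force the tile and its other two labels. *)
Lemma labels_outside_young (a b : 'I_n) : (a, b) \notin young (lambda w) ->
  [/\ left_label a b = (if w a < b then Some (w a) else None),
      bottom_label a b = (if (w^-1)%g b <= a then Some b else None)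
    & top_label P rule a b = (if (w^-1)%g b < a then Some b else None)].
Proof.
have [m] := ubnP ((n - a) + (n - b)); elim: m a b => // m IHm a b ltm out.
have [lta ltb] := (ltn_ord a, ltn_ord b).
have outS (a' b' : 'I_n) : a <= a' -> b <= b' -> (a', b') \notin young (lambda w).
  move=> lea leb; move: out; rewrite !inE /= -!leqNgt => out.
  exact: leq_trans (lambda_noninc w lea) (leq_trans out leb).
have bottomE : bottom_label a b = if (w^-1)%g b <= a then Some b else None.
  have [lta1|] := ltnP a.+1 n.
    have [|_ _ topE] := IHm (Ordinal lta1) b _ (outS (Ordinal lta1) b (leqnSn _) (leqnn _)).
      by rewrite /=; lia.
    by rewrite bottom_labelE topE.
  move=> lena; have eqa : a = n.-1 :> nat by lia.
  by rewrite eqa bottom_label_boundary valK -ltnS prednK ?ltn_ord //; lia.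
have rightE : left_label a b.+1 = if w a <= b then Some (w a) else None.
  have [ltb1|] := ltnP b.+1 n.
    have [|leftE _ _] := IHm a (Ordinal ltb1) _ (outS a (Ordinal ltb1) (leqnn _) (leqnSn _)).
      by rewrite /=; lia.
    by rewrite leftE.
  move=> lenb; have eqb : b.+1 = n by lia.
  by rewrite eqb right_boundary_label -ltnS eqb ltn_ord.
(* By [bottomE] and [rightE], the bottom or the right edge carries a label, which rules out blank
   tiles and upward elbows. *)
have notD : ~~ ((b < w a) && (a < (w^-1)%g b)).
  apply: contra out => D; rewrite inE /lambda /=.
  by apply: (bigmax_sup (a, b)); rewrite //= inE /= D leqnn.
have eq_wa : (w a == b :> nat) = ((w^-1)%g b == a :> nat).
  by rewrite !(inj_eq (@ord_inj n)) (canF_eq (permK w)) eq_sym.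
(* At a crossing with [b] below, the left label is smaller than [b], so it leaves to the right and
   must be [w a]. *)
have left_lt := (left_bottom_label_le P a b).1.
have := left_label_isSome P rule lta ltb.
have := bottom_label_isSome P rule lta ltb.
rewrite (top_labelE P rule) // left_labelS /exit_at tile_at_ord in rightE *.
rewrite bottomE in rightE *.
case: (ltngtP ((w^-1)%g b) a) eq_wa rightE notD => /= cmpa;
  case: (ltngtP (w a) b) => //= cmpb _ rightE _; move: rightE left_lt;
  case: (P a b) (left_label a b) => [] [x|] //= rightE left_lt _ _; try by split.
- by case: rightE cmpb => <-; rewrite ltnn.
- by move: rightE; rewrite /demazure_rule ltnW ?left_lt //= => ->; split.
- move: rightE; rewrite /demazure_rule ltnW ?left_lt //= => -[eqx].
  by have := left_lt x erefl; rewrite eqx cmpb ltnn.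
Qed.

Lemma crossing_outside_young (a b : 'I_n) :
    (a, b) \notin young (lambda w) -> P a b = Crossing ->
  [/\ left_label a b = Some (w a), bottom_label a b = Some b & w a < b].
Proof.
move=> out cross; have [leftE bottomE _] := labels_outside_young out.
have := bottom_label_isSome P rule (ltn_ord a) (ltn_ord b).
have := left_label_isSome P rule (ltn_ord a) (ltn_ord b).
rewrite !tile_at_ord cross leftE bottomE.
by case: ifP => // ltwb _; case: ifP.
Qed.

(** * Patterns 2143 and crossings inside the Young diagram *)

Lemma crossing_in_young_of_not_vexillary : ~~ vexillary w ->
  exists c : 'I_n * 'I_n, c \in young (lambda w) /\ P c.1 c.2 = Crossing.
Proof.
rewrite negbK => /existsP[i1 /existsP[i2 /existsP[i3 /existsP[i4]]]].
case/and5P=> lt12 lt23 lt34 ltw21 /andP[ltw14 ltw43].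
have [] := @crossing_of_inversion (w i2) (w i1) ltw21; first by rewrite !permK.
move=> a [b [cross leftE bottomE]]; exists (a, b); split=> //.
apply/negPn/negP => out.
have [] := crossing_outside_young out cross.
rewrite leftE bottomE => -[/perm_inj eqa] [eqb] _.
case/negP: out; rewrite young_lambda; apply/bigcupP; exists (i3, w i4).
  by rewrite inE /= permK ltw43.
by rewrite inE /= -eqa -eqb (ltnW lt23) ltnW.
Qed.

Lemma not_vexillary_of_crossing_in_young (a b : 'I_n) :
  (a, b) \in young (lambda w) -> P a b = Crossing -> ~~ vexillary w.
Proof.
rewrite young_lambda => /bigcupP[[i j]].
rewrite !inE /= => /andP[ltj lti] /andP[leai lebj] cross.
have := bottom_label_isSome P rule (ltn_ord a) (ltn_ord b).
have := left_label_isSome P rule (ltn_ord a) (ltn_ord b).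
rewrite !tile_at_ord cross.
case leftE: (left_label a b) => [x|] // _.
case bottomE: (bottom_label a b) => [y|] // _.
have [left_lt bottom_le] := left_bottom_label_le P a b.
have ltxj := leq_trans (left_lt x leftE) lebj.
have leyj := leq_trans (bottom_le y bottomE) lebj.
have lexa := exit_row_le (or_introl leftE).
have leya := exit_row_le (or_intror bottomE).
have neq_xy : x != y :> nat.
  apply/eqP => /ord_inj eqxy; rewrite -eqxy in bottomE.
  have := count_frontier P x (ltn_ord a) (ltnW (ltn_ord b)).
  have [s1 [s2 [-> _]]] := frontier_step P rule (ltn_ord a) (ltn_ord b).
  by rewrite leftE bottomE !count_cat /= eqxx; lia.
(* The values [q], [p], [w i], [j] form the 2143. Equality in the weak bounds is excluded:
   [p <= j < w i] gives [w^-1 p != i], and [w^-1 q <= i < w^-1 j] gives [q != j]. *)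
have pattern (p q : 'I_n) : p < q -> p <= j -> q <= j ->
    (w^-1)%g p <= a -> (w^-1)%g q <= a ->
    (w^-1)%g q < (w^-1)%g p -> ~~ vexillary w.
  move=> ltpq lepj leqj lepa leqa ltqp; rewrite negbK.
  apply/existsP; exists ((w^-1)%g q); apply/existsP; exists ((w^-1)%g p).
  apply/existsP; exists i; apply/existsP; exists ((w^-1)%g j).
  rewrite !permKV ltqp lti ltpq ltj /= andbT.
  have nepi : (w^-1)%g p != i :> nat.
    by apply/eqP => /ord_inj eqi; move: ltj; rewrite -eqi permKV; lia.
  have neqj : q != j :> nat.
    by apply/eqP => /ord_inj eqj; move: lti; rewrite -eqj; lia.
  by lia.
case: (ltngtP x y) neq_xy => // ltxy _.
  apply: (pattern x y) => //; first exact: ltnW.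
  by apply: (inversion_of_crossing ltxy cross); left.
apply: (pattern y x) => //; first exact: ltnW.
by apply: (inversion_of_crossing ltxy cross); right.
Qed.

Lemma crossing_outside_young_of_vexillary (a b : 'I_n) :
  vexillary w -> P a b = Crossing -> (a, b) \notin young (lambda w).
Proof.
by move=> vex cross; apply: contraTN vex => /not_vexillary_of_crossing_in_young; apply.
Qed.

(** * Reducedness in the vexillary case *)

(** Every crossing lies outside the Young diagram and is entered by the smaller label from the left,
    where [demazure_rule] and [straight_rule] agree. *)
Lemma straight_labels_of_vexillary : vexillary w ->
  forall i j, i < n -> j < n ->
    Defs.left_label (@straight_rule n) P i j = left_label i j /\
    Defs.bottom_label (@straight_rule n) P i j = bottom_label i j.
Proof.
move=> vex.
have exitE (i j : nat) : i < n -> j < n ->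
    exit_labels (@straight_rule n) (tile_at P i j)
      (left_label i j) (bottom_label i j) =
    exit_at P rule i j.
  move=> lti ltj; rewrite /exit_at.
  rewrite -[i]/(val (Ordinal lti)) -[j]/(val (Ordinal ltj)) tile_at_ord.
  case cross: (P _ _) => //.
  have out := crossing_outside_young_of_vexillary vex cross.
  have [-> -> ltwj] := crossing_outside_young out cross.
  by have [-> _] := crossing_exit ltwj.
have leftE (i : nat) : i < n ->
    (forall j, j < n ->
       Defs.bottom_label (@straight_rule n) P i j = bottom_label i j) ->
    forall j, j < n ->
      Defs.left_label (@straight_rule n) P i j = left_label i j.
  move=> lti botE; elim=> [//|j IHj] ltj.
  by rewrite !left_labelS -exitE ?(ltnW ltj) // /exit_at IHj ?botE // ltnW.
have bottomE k (i j : nat) : i + k = n.-1 -> i < n -> j < n ->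
    Defs.bottom_label (@straight_rule n) P i j = bottom_label i j.
  elim: k i j => [|k IHk] i j.
    by rewrite addn0 => -> _ ltj; rewrite !bottom_label_boundary.
  move=> eqi lti ltj; have lti1 : i.+1 < n by lia.
  have botE j' : j' < n ->
      Defs.bottom_label (@straight_rule n) P i.+1 j' = bottom_label i.+1 j'.
    by move=> ?; apply: IHk; rewrite ?addSnnS.
  by rewrite !bottom_labelE !top_labelE // -exitE // /exit_at leftE // botE.
have botE (i j : nat) : i < n -> j < n ->
    Defs.bottom_label (@straight_rule n) P i j = bottom_label i j.
  by move=> lti; apply: (bottomE (n.-1 - i)) => //; lia.
by move=> i j lti ltj; split; [apply: leftE => // j' ?; apply: botE | apply: botE].
Qed.

Lemma reduced_of_vexillary : vexillary w -> reduced P.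
Proof.
move=> vex; apply/forallP => p; apply/forallP => q; apply/implyP => neq_pq.
have crossE (a b : 'I_n) : (a, b) \in crossings P p q ->
    w a < b /\ ((w a = p /\ b = q) \/ (w a = q /\ b = p)).
  rewrite inE /= => /andP[/eqP cross].
  have [-> ->] := straight_labels_of_vexillary vex (ltn_ord a) (ltn_ord b).
  have out := crossing_outside_young_of_vexillary vex cross.
  have [-> -> ltwb] := crossing_outside_young out cross.
  by case/orP => /eqP[Ea Eb]; split=> //; [left | right].
rewrite leqNgt; apply/negP => /card_gt1P[[a b] [[a' b']]].
case=> /crossE[ltab Eab] /crossE[ltab' Eab'].
(* At both cells the row value is the smaller of [p], [q] and the column the larger, so the cells
   coincide. *)
case/negP; apply/eqP; congr pair; [apply: (@perm_inj _ w)|];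
  by case: Eab ltab => -[-> ->]; case: Eab' ltab' => -[-> ->] // ? ?; lia.
Qed.

End DemazureProduct.

Theorem lemma7p2 (n : nat) (w : 'S_n) :
  (forall P : bpd n, P \in Pipes w ->
     ((exists c : 'I_n * 'I_n,
         c \in young (lambda w) /\ P c.1 c.2 = Crossing) <->
      ~~ vexillary w)) /\
  (vexillary w -> RPipes w = Pipes w).
Proof.
split=> [P Pw|vex].
  split; last exact: crossing_in_young_of_not_vexillary.
  by case=> -[a b] [] /(not_vexillary_of_crossing_in_young Pw) H /H.
apply/setP => P; rewrite inE andb_idr // => Pw.
exact: reduced_of_vexillary Pw vex.
Qed.
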